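(* Let $f(z)=z^{p}+\sum_{k=n}^{\infty}a_{k+p}z^{k+p}$ and $g(z)=z^{p}+\sum_{k=n}^{\infty}b_{k+p}z^{k+p}$ belong to $\mathcal{F}(\lambda,m,\Omega)$, where $p>m$. Suppose that for some real $\alpha,\beta$ with $-\pi\le\alpha-\beta\le\pi$ and some $\delta>\frac{p!}{(p-m)!}\sqrt{2[1-\cos(\alpha-\beta)]}$, $$\sum_{k=n}^{\infty}\frac{(k+p-m)^{\Omega}(k+p)!\,(1+\lambda k(p-m)^{-1})}{(p-m)^{\Omega}(k+p-m)!}\left|e^{i\alpha}a_{k+p}-e^{i\beta}b_{k+p}\right|\le\delta-\frac{p!}{(p-m)!}\sqrt{2[1-\cos(\alpha-\beta)]}.$$ Then $f\in(\alpha,\beta,\lambda,m,\delta,\Omega)_{p}\text{-}M(g)$.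
   Context: Let $\mathcal{U}=\{z\in\mathbb{C}:|z|<1\}$, $\mathbb{N}=\{1,2,3,\dots\}$, $\mathbb{N}_0=\mathbb{N}\cup\{0\}$. Throughout $n,p\in\mathbb{N}$, $m,\Omega\in\mathbb{N}_0$, $p>m$, $0\le\lambda\le1$, and the coefficients are complex. For $f(z)=z^{p}+\sum_{k=n}^{\infty}a_{k+p}z^{k+p}$ analytic in $\mathcal{U}$, $f^{(m)}$ is its $m$-th derivative. The (Salagean type) operator is $D^{0}f^{(m)}(z)=f^{(m)}(z)$, $D^{1}f^{(m)}(z)=\frac{z}{p-m}(f^{(m)}(z))'$, $D^{\Omega}f^{(m)}=D(D^{\Omega-1}f^{(m)})$. Define $$\mathcal{F}(f^{(m)}(z))=(1-\lambda)D^{\Omega}f^{(m)}(z)+\frac{\lambda z}{p-m}\left(D^{\Omega}f^{(m)}(z)\right)'=\frac{p!}{(p-m)!}z^{p-m}+\sum_{k=n}^{\infty}\frac{(k+p)!(k+p-m)^{\Omega}(1+\lambda k(p-m)^{-1})}{(p-m)^{\Omega}(k+p-m)!}a_{k+p}z^{k+p-m}.$$ ''$f\in\mathcal{F}(\lambda,m,\Omega)$'' means that $f(z)=z^{p}+\sum_{k\ge n}a_{k+p}z^{k+p}$ has coefficients such that this last function is analytic in $\mathcal{U}$ (equivalently, $f$ is analytic in $\mathcal{U}$). Quotients by powers of $z$ are understood at $z=0$ by removing the singularity. For $f,g\in\mathcal{F}(\lambda,m,\Omega)$, real $\alpha,\beta$ with $-\pi\le\alpha-\beta\le\pi$, and $\delta>\frac{p!}{(p-m)!}\sqrt{2[1-\cos(\alpha-\beta)]}$,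 one writes $f\in(\alpha,\beta,\lambda,m,\delta,\Omega)_p\text{-}M(g)$ if $$\left|\frac{e^{i\alpha}\mathcal{F}(f^{(m)}(z))}{z^{p-m}}-\frac{e^{i\beta}\mathcal{F}(g^{(m)}(z))}{z^{p-m}}\right|<\delta\qquad(z\in\mathcal{U}).$$ *)

(* Defs.v *)
From HB Require Import structures.
From mathcomp Require Import all_boot all_order all_algebra.
From mathcomp Require Import complex.
From mathcomp Require Import all_classical all_reals all_analysis.

Set Implicit Arguments.
Unset Strict Implicit.
Unset Printing Implicit Defensive.

Import Order.TTheory GRing.Theory Num.Theory.
Import numFieldNormedType.Exports.

Local Open Scope classical_set_scope.
Local Open Scope ring_scope.
Local Open Scope complex_scope.

(* [R[i]] packaged as a [numClosedFieldType]: this is what makes the canonical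
   topology and normed-module structure of a numeric field available, so that
   [derive1], [derivable] and [lim] below are the complex ones.  The norm
   [`|z|] is the complex modulus, seen as an element of [Cplx R]. *)
Definition Cplx (R : realType) : numClosedFieldType := R[i].

Definition ofreal (R : realType) (x : R) : Cplx R := x%:C.

Definition modulus (R : realType) (z : Cplx R) : R := Normc.normc (z : R[i]).

Definition expi (R : realType) (t : R) : Cplx R := cos t +i* sin t.

Definition unit_disc (R : realType) : set (Cplx R) := [set z | `|z| < 1].

Definition analytic_on_disc (R : realType) (h : Cplx R -> Cplx R) : Prop :=
  forall z : Cplx R, unit_disc z -> derivable h z 1.

(* f(z) = z^p + \sum_(k >= n) a_(k+p) z^(k+p) in the unit disc.  The values of
   [f] outside the disc and the entries [a j] with [j < n + p] are irrelevant. *)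
Definition has_expansion (R : realType) (n p : nat)
    (a : nat -> Cplx R) (f : Cplx R -> Cplx R) : Prop :=
  forall z : Cplx R, unit_disc z ->
    (fun N : nat => z ^+ p + \sum_(n <= k < N) a (k + p)%N * z ^+ (k + p))
      @ \oo --> f z.

(* h |-> z h'(z) / (p - m) *)
Definition salagean (R : realType) (p m : nat) (h : Cplx R -> Cplx R) :
    Cplx R -> Cplx R :=
  fun z => z / (p - m)%:R * derive1 h z.

(* h |-> (1 - lambda) D^Omega h + lambda z (D^Omega h)' / (p - m) *)
Definition calF (R : realType) (p m : nat) (lambda : R) (Omega : nat)
    (h : Cplx R -> Cplx R) : Cplx R -> Cplx R :=
  fun z =>
    (1 - ofreal lambda) * iter Omega (salagean p m) h z
    + ofreal lambda * z / (p - m)%:R * derive1 (iter Omega (salagean p m) h) z.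

(* The class F(lambda, m, Omega): [f] has the given expansion and the transform
   of its m-th derivative is analytic in the disc. *)
Definition in_class (R : realType) (n p : nat) (lambda : R) (m Omega : nat)
    (a : nat -> Cplx R) (f : Cplx R -> Cplx R) : Prop :=
  has_expansion n p a f /\
  analytic_on_disc (calF p m lambda Omega (derive1n m f)).

(* h(z) / z^d, with the singularity at 0 removed. *)
Definition quot_pow (R : realType) (d : nat) (h : Cplx R -> Cplx R) :
    Cplx R -> Cplx R :=
  fun z => if z == 0 then lim (h w / w ^+ d @[w --> (0 : Cplx R)^'])
           else h z / z ^+ d.

(* p! / (p - m)! * sqrt (2 (1 - cos (alpha - beta))) *)
Definition delta_bound (R : realType) (p m : nat) (alpha beta : R) : R :=
  p`!%:R / (p - m)`!%:R * Num.sqrt (2 * (1 - cos (alpha - beta))).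

(* f \in (alpha, beta, lambda, m, delta, Omega)_p-M(g) *)
Definition in_M (R : realType) (alpha beta lambda : R) (m : nat) (delta : R)
    (Omega p : nat) (g f : Cplx R -> Cplx R) : Prop :=
  forall z : Cplx R, unit_disc z ->
    `| expi alpha * quot_pow (p - m) (calF p m lambda Omega (derive1n m f)) z
       - expi beta * quot_pow (p - m) (calF p m lambda Omega (derive1n m g)) z |
    < ofreal delta.

(* Coefficient of a_(k+p) z^(k+p-m) in calF (f^(m)). *)
Definition coef (R : realType) (p m : nat) (lambda : R) (Omega k : nat) : R :=
  ((k + p - m) ^ Omega)%:R * (k + p)`!%:R * (1 + lambda * k%:R / (p - m)%:R)
  / (((p - m) ^ Omega)%:R * (k + p - m)`!%:R).

(* Main.v *)
Require Import Defs.
From mathcomp Require Import all_boot all_order all_algebra.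
From mathcomp Require Import complex.
From mathcomp Require Import all_classical all_reals all_analysis.
From mathcomp Require Import ring lra.

Set Implicit Arguments.
Unset Strict Implicit.
Unset Printing Implicit Defensive.

Import Order.TTheory GRing.Theory Num.Theory.
Import numFieldNormedType.Exports.

Local Open Scope classical_set_scope.
Local Open Scope ring_scope.

(* A power series that converges in the unit disc may be differentiated
   termwise, so F(f^(m)) / z^(p-m) is the sum of the power series with
   coefficients [coef k * a_(k+p)].  In the difference
   [e^(i alpha) F(f^(m)) - e^(i beta) F(g^(m))] divided by z^(p-m), the constant
   term has modulus [delta_bound], and the other terms add up to at most
   [|z| (delta - delta_bound)] because n > 0; since |z| < 1 and
   delta_bound < delta the total is strictly less than delta. *)

(** * The complex modulus as a real-valued norm *)

Lemma normE (R : realType) (z : Cplx R) : `|z| = ofreal (modulus z).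
Proof. by []. Qed.

Lemma ltc_ofreal (R : realType) (x y : R) : (ofreal x < ofreal y) = (x < y).
Proof. exact: ltcR. Qed.

Lemma modulus_ge0 (R : realType) (z : Cplx R) : 0 <= modulus z.
Proof. by case: z => x y; exact: sqrtr_ge0. Qed.

Lemma modulusM (R : realType) (x y : Cplx R) :
  modulus (x * y) = modulus x * modulus y.
Proof. exact: Normc.normcM. Qed.

Lemma modulusX (R : realType) (x : Cplx R) n :
  modulus (x ^+ n) = modulus x ^+ n.
Proof.
elim: n => [|n IH]; first by rewrite !expr0; exact: Normc.normc1.
by rewrite !exprS modulusM IH.
Qed.

Lemma ler_modulusD (R : realType) (x y : Cplx R) :
  modulus (x + y) <= modulus x + modulus y.
Proof. exact: le_normcD. Qed.

Lemma modulusN (R : realType) (x : Cplx R) : modulus (- x) = modulus x.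
Proof. exact: normcN. Qed.

Lemma modulus0 (R : realType) : modulus (0 : Cplx R) = 0.
Proof. exact: Normc.normc0. Qed.

Lemma modulus_ofreal (R : realType) (x : R) : modulus (ofreal x) = `|x|.
Proof. by rewrite /modulus /= expr0n addr0 sqrtr_sqr. Qed.

Lemma modulus_natr (R : realType) n : modulus (n%:R : Cplx R) = n%:R.
Proof.
rewrite -[n%:R in LHS](rmorph_nat (real_complex R)) -[LHS]/(modulus (ofreal _)).
by rewrite modulus_ofreal normr_nat.
Qed.

Lemma ler_modulus_sum (R : realType) (u : nat -> Cplx R) N :
  modulus (\sum_(0 <= k < N) u k) <= \sum_(0 <= k < N) modulus (u k).
Proof.
elim: N => [|N IH]; first by rewrite !big_nil modulus0.
by rewrite !big_nat_recr//= (le_trans (ler_modulusD _ _))// lerD2r.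
Qed.

Lemma ler_Re_modulus (R : realType) (z : Cplx R) :
  `|complex.Re (z : R[i])| <= modulus z.
Proof.
case: z => x y /=; rewrite /modulus /= -sqrtr_sqr ler_sqrt ?addr_ge0 ?sqr_ge0//.
by rewrite lerDl sqr_ge0.
Qed.

Lemma ler_Im_modulus (R : realType) (z : Cplx R) :
  `|complex.Im (z : R[i])| <= modulus z.
Proof.
case: z => x y /=; rewrite /modulus /= -sqrtr_sqr ler_sqrt ?addr_ge0 ?sqr_ge0//.
by rewrite lerDr sqr_ge0.
Qed.

Lemma unit_discE (R : realType) (z : Cplx R) :
  unit_disc z = (modulus z < 1) :> Prop.
Proof. by rewrite /unit_disc /= normE -[1 in LHS]/(ofreal 1) ltc_ofreal. Qed.

(** Transfers complex limits to the real line, where squeezing and comparison of series are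
    available. *)
Lemma cvg_modulusP (R : realType) (T : Type) (F : set_system T) {FF : Filter F}
    (u : T -> Cplx R) (l : Cplx R) :
  (u t @[t --> F] --> l) <-> (modulus (u t - l) @[t --> F] --> (0 : R)).
Proof.
split=> [/cvgrPdist_lt ul|/cvgrPdist_lt ul].
  apply/cvgrPdist_lt => e e0.
  have e0' : 0 < ofreal e by rewrite -[0]/(ofreal 0) ltc_ofreal.
  near=> t.
  rewrite sub0r normrN ger0_norm ?modulus_ge0// -ltc_ofreal -normE distrC.
  by near: t; exact: ul.
apply/cvgrPdist_lt => e e0.
(* In the order of [Cplx R], [0 < e] forces the imaginary part of [e] to vanish. *)
have [eE re0] : e = ofreal (complex.Re (e : R[i])) /\ 0 < complex.Re (e : R[i]).
  move: e0; case: e => x y; rewrite ltcE /= => /andP[/eqP /= y0 x0].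
  by rewrite y0 in x0 *.
near=> t.
rewrite eE normE ltc_ofreal -modulusN opprB.
have : `|0 - modulus (u t - l)| < complex.Re (e : R[i]) by near: t; exact: ul.
by rewrite sub0r normrN ger0_norm ?modulus_ge0.
Unshelve. all: by end_near. Qed.

Lemma modulus_cvg_le (R : realType) (u : nat -> Cplx R) (l : Cplx R) (B : R) :
  u @ \oo --> l -> (forall n, modulus (u n) <= B) -> modulus l <= B.
Proof.
move=> /cvg_modulusP /cvgrPdist_lt ul uB; apply/ler_addgt0Pr => e e0.
have [N _ /(_ N (leqnn N))] := ul e e0;
  rewrite /= sub0r normrN ger0_norm ?modulus_ge0// => uNl.
have -> : l = u N - (u N - l) by rewrite opprB addrC subrK.
rewrite (le_trans (ler_modulusD _ _))// lerD ?uB// modulusN; exact: ltW.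
Qed.

(** * Power series in the disc and their absolute convergence *)

Definition power_series_on_disc (R : realType) (c : nat -> Cplx R)
    (h : Cplx R -> Cplx R) : Prop :=
  forall z, unit_disc z -> series (fun k => c k * z ^+ k) @ \oo --> h z.

Definition abs_summable (R : realType) (c : nat -> Cplx R) : Prop :=
  forall r : R, 0 <= r < 1 -> cvgn (series (fun k => modulus (c k) * r ^+ k)).

Definition deriv_coef (R : realType) (c : nat -> Cplx R) : nat -> Cplx R :=
  fun k => k.+1%:R * c k.+1.

Lemma exists_between01 (R : realType) (r : R) :
  r < 1 -> exists2 s, r < s & s < 1.
Proof. by move=> r1; exists ((r + 1) / 2); rewrite ?midf_lt. Qed.

(** Abel's argument: for [r < s < 1] the terms at [s] tend to 0, so their moduli are bounded by some
    [M], and the terms at [r] are dominated by the geometric series with ratio [r / s]. *)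
Lemma power_series_abs_summable (R : realType) (c : nat -> Cplx R) h :
  power_series_on_disc c h -> abs_summable c.
Proof.
move=> ch r /andP[r0 r1]; have [s rs s1] := exists_between01 r1.
have s0 : 0 < s by apply: le_lt_trans rs.
have ds : unit_disc (ofreal s) by rewrite unit_discE modulus_ofreal gtr0_norm.
have /cvg_series_cvg_0/cvg_modulusP := cvgP _ (ch _ ds).
move=> /cvgP/cvg_seq_bounded/bounded_fun_has_ubound[M cM].
have {}cM k : modulus (c k) * s ^+ k <= M.
  rewrite -[s]gtr0_norm// -modulus_ofreal -modulusX -modulusM.
  by apply: cM; exists k => //; rewrite subr0.
have M0 : 0 <= M by apply: le_trans (cM 0%N); rewrite mulr_ge0 ?modulus_ge0.
apply: (@series_le_cvg _ _ (geometric M (r / s))) => [k|k|k|].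
- by rewrite mulr_ge0 ?modulus_ge0 ?exprn_ge0.
- by rewrite /= mulr_ge0 ?exprn_ge0 ?divr_ge0 // ltW.
- rewrite /= expr_div_n mulrA ler_pdivlMr ?exprn_gt0// mulrAC.
  by rewrite ler_wpM2r ?exprn_ge0.
- apply: is_cvg_geometric_series.
  by rewrite ger0_norm ?divr_ge0// ?ltr_pdivrMr ?mul1r// ltW.
Qed.

Lemma is_cvg_series_shiftS (R : realType) (u : nat -> R) :
  cvgn (series u) -> cvgn (series (fun k => u k.+1)).
Proof.
move=> /cvg_ex[l ul]; apply/cvg_ex; exists (l - u 0%N).
have -> : series (fun k => u k.+1) = (fun n => series u n.+1 - u 0%N).
  by apply/funext => n; rewrite /series /= big_nat_recl// addrAC subrr add0r.
by apply: cvgB; [rewrite cvg_shiftS | exact: cvg_cst].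
Qed.

(* [s ^+ k.+1 - r ^+ k.+1] is [s - r] times a sum of
   [k.+1] products each at least [r ^+ k]. *)
Lemma ler_natM_expr (R : realType) (r s : R) k :
  0 <= r -> r <= s -> k.+1%:R * r ^+ k * (s - r) <= s ^+ k.+1.
Proof.
move=> r0 rs; rewrite -[leRHS](subrK (r ^+ k.+1)) subrXX -[leLHS]addr0.
rewrite lerD ?exprn_ge0// mulrC ler_wpM2l ?subr_ge0//.
rewrite mulr_natl -[in leLHS](card_ord k.+1) -sumr_const ler_sum// => i _.
have ik : (i <= k)%N by rewrite -ltnS.
rewrite /= -[in leLHS](subnK ik) exprD.
by rewrite ler_wpM2r ?exprn_ge0// lerXn2r ?nnegrE// (le_trans r0).
Qed.

(** For [r < s < 1], [ler_natM_expr] absorbs the factor [k.+1] at the cost of the constant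
    [(s - r)^-1]: the derived series at [r] is dominated by the shifted original series at [s]. *)
Lemma abs_summable_deriv (R : realType) (c : nat -> Cplx R) :
  abs_summable c -> abs_summable (deriv_coef c).
Proof.
move=> ac r /andP[r0 r1]; have [s rs s1] := exists_between01 r1.
have s0 : 0 < s by apply: le_lt_trans rs.
apply: (@series_le_cvg _ _
    (fun k => (s - r)^-1 * (modulus (c k.+1) * s ^+ k.+1))) => [k|k|k|].
- by rewrite mulr_ge0 ?modulus_ge0 ?exprn_ge0.
- by rewrite !mulr_ge0 ?modulus_ge0 ?exprn_ge0 ?invr_ge0 ?subr_ge0// ltW.
- rewrite ler_pdivlMl ?subr_gt0// modulusM modulus_natr.
  rewrite [leLHS](_ : _ = modulus (c k.+1) * (k.+1%:R * r ^+ k * (s - r)));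
    last by ring.
  by rewrite ler_wpM2l ?modulus_ge0// ler_natM_expr// ltW.
- apply: is_cvg_seriesZ.
  apply: (@is_cvg_series_shiftS _ (fun k => modulus (c k) * s ^+ k)).
  by apply: ac; rewrite s1 ltW.
Qed.

Lemma ler_modulus_ReIm (R : realType) (z : Cplx R) :
  modulus z <= `|complex.Re (z : R[i])| + `|complex.Im (z : R[i])|.
Proof.
case: z => x y; rewrite /modulus /=.
rewrite -[leRHS]ger0_norm ?addr_ge0// -sqrtr_sqr ler_sqrt ?sqr_ge0//.
rewrite sqrrD !real_normK ?num_real// lerD2r lerDl.
by rewrite mulrn_wge0// mulr_ge0.
Qed.

(** The real and imaginary parts are real series dominated by the moduli, hence convergent; their
    limits assemble into the complex one. *)
Lemma is_cvg_complex_series (R : realType) (u : nat -> Cplx R) :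
  cvgn (series (fun k => modulus (u k))) -> cvgn (series u).
Proof.
move=> cu.
have reim (F : Cplx R -> R) : (forall x y, F (x + y) = F x + F y) -> F 0 = 0 ->
    (forall z, `|F z| <= modulus z) ->
    exists l : R, F (series u n) @[n --> \oo] --> l.
  move=> FD F0 FM.
  have FS : (fun n => F (series u n)) = series (F \o u).
    apply/funext => n; rewrite /series /=.
    by elim: n => [|n IH]; rewrite ?big_nil// !big_nat_recr//= FD IH.
  suff : cvgn (series (F \o u)).
    by rewrite -FS => Fu; exists (limn (fun n => F (series u n))).
  by apply: normed_cvg; apply: series_le_cvg cu => k /=; rewrite ?modulus_ge0.
have [|||x xl] := reim (fun z => complex.Re (z : R[i])).
- by move=> [? ?] [? ?].
- by [].
- exact: ler_Re_modulus.
have [|||y yl] := reim (fun z => complex.Im (z : R[i])).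
- by move=> [? ?] [? ?].
- by [].
- exact: ler_Im_modulus.
apply/cvg_ex; exists ((x +i* y)%C : Cplx R); apply/cvg_modulusP.
have B0 : `|complex.Re (series u n : R[i]) - x| +
    `|complex.Im (series u n : R[i]) - y| @[n --> \oo] --> (0 : R).
  rewrite -[X in _ --> X](addr0 (0 : R)).
  by apply: cvgD; rewrite -[X in _ --> X](normr0 R); apply: cvg_norm;
    apply/subr_cvg0.
apply: (squeeze_cvgr _ (cvg_cst 0) B0).
have ReImB (z : Cplx R) :
    modulus (z - (x +i* y)%C) <=
    `|complex.Re (z : R[i]) - x| + `|complex.Im (z : R[i]) - y|.
  by apply: le_trans (ler_modulus_ReIm _) _; case: z.
by apply: nearW => n; rewrite modulus_ge0 ReImB.
Qed.

(** * First-order Taylor estimate and termwise differentiation *)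

(** The remainders satisfy E_(k+1) = w E_k + k z^(k-1) (w - z)^2, which gives an induction. The
    constant is the second derivative of r^k; the usual factor 1/2 is given up to keep the induction
    short. *)
Lemma modulus_taylor1_expr (R : realType) (w z : Cplx R) (r : R) k :
  modulus w <= r -> modulus z <= r ->
  modulus (w ^+ k - z ^+ k - k%:R * z ^+ k.-1 * (w - z))
    <= k%:R * k.-1%:R * r ^+ k.-2 * modulus (w - z) ^+ 2.
Proof.
move=> wr zr; have r0 : 0 <= r := le_trans (modulus_ge0 _) wr.
elim: k => [|[|j] IH].
- by rewrite !expr0 subrr !mul0r subr0 modulus0.
- by rewrite !expr1 expr0 !mul1r subrr modulus0 !mul0r.
set E := (X in modulus X <= _) in IH *.
have -> : w ^+ j.+2 - z ^+ j.+2 - j.+2%:R * z ^+ j.+1 * (w - z) =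
    w * E + j.+1%:R * z ^+ j * (w - z) ^+ 2.
  by rewrite /E /= !(exprS w) !(exprS z); ring.
apply: le_trans (ler_modulusD _ _) _.
rewrite !modulusM !modulusX modulus_natr /=.
set d := modulus (w - z); have d2 : 0 <= d ^+ 2 := sqr_ge0 _.
apply: (@le_trans _ _ (r * (j.+1%:R * j%:R * r ^+ j.-1 * d ^+ 2) +
                       j.+1%:R * r ^+ j * d ^+ 2)).
  apply: lerD; first by rewrite ler_pM ?modulus_ge0.
  rewrite ler_wpM2r// ler_wpM2l//.
  by rewrite lerXn2r ?nnegrE ?modulus_ge0.
have -> : r * (j.+1%:R * j%:R * r ^+ j.-1 * d ^+ 2)
  = j.+1%:R * j%:R * r ^+ j * d ^+ 2.
  by case: j {IH E} => [|j]; rewrite ?mulr0 ?mul0r ?mulr0//= (exprS r); ring.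
rewrite -mulrDl ler_wpM2r// -mulrDl.
rewrite ler_wpM2r ?exprn_ge0// -[X in _ + X]mulr1 -mulrDr natr1 mulrC.
by rewrite ler_wpM2r// ler_nat.
Qed.

Lemma series_deriv_coef (R : realType) (c : nat -> Cplx R) z N :
  \sum_(0 <= k < N.+1) c k * (k%:R * z ^+ k.-1)
    = series (fun k => deriv_coef c k * z ^+ k) N.
Proof.
rewrite big_nat_recl// mul0r mulr0 add0r.
by apply: eq_bigr => k _; rewrite /deriv_coef /=; ring.
Qed.

(** Sums the estimate for monomials against the coefficients. [K] bounds the partial sums of the
    twice derived series of moduli at [r], so it does not depend on [w]; differentiability and
    continuity both follow from this bound. *)
Lemma power_series_taylor1 (R : realType) (c : nat -> Cplx R) h z
    (r : R) (D : Cplx R) :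
  power_series_on_disc c h -> modulus z <= r -> r < 1 ->
  series (fun k => deriv_coef c k * z ^+ k) @ \oo --> D ->
  exists K : R, forall w, modulus w <= r ->
    modulus (h w - h z - D * (w - z)) <= K * modulus (w - z) ^+ 2.
Proof.
move=> ch zr r1 cD; have r0 : 0 <= r := le_trans (modulus_ge0 _) zr.
have /abs_summable_deriv/abs_summable_deriv ac := power_series_abs_summable ch.
have r01 : 0 <= r < 1 by rewrite r0.
have /cvg_seq_bounded/bounded_fun_has_ubound[K Kub] := ac _ r01.
exists K => w wr.
have inD u : modulus u <= r -> unit_disc u.
  by rewrite unit_discE => /le_lt_trans; exact.
pose S u := series (fun k => c k * u ^+ k).
(* The [N.+2] terms of the series correspond to [N.+1] terms of its derivative, and leave [N] terms
   of the second derivative. *)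
apply: (@modulus_cvg_le _ (fun N => S w N.+2 - S z N.+2 -
    series (fun k => deriv_coef c k * z ^+ k) N.+1 * (w - z))).
  have S2 u : modulus u <= r -> S u N.+2 @[N --> \oo] --> h u.
    by move=> ur; rewrite (cvg_shiftS (fun n => S u n.+1)) cvg_shiftS;
      apply: ch; exact: inD.
  apply: cvgB; first by apply: cvgB; exact: S2.
  by apply: cvgM (cvg_cst _); rewrite (cvg_shiftS (series _)).
move=> N; rewrite -series_deriv_coef /S /series /= mulr_suml -!sumrB.
apply: le_trans (ler_modulus_sum _ _) _.
apply: (@le_trans _ _ (\sum_(0 <= k < N.+2)
   (modulus (c k) * (k%:R * k.-1%:R * r ^+ k.-2)) * modulus (w - z) ^+ 2)).
  apply: ler_sum => k _.
  rewrite -[leRHS]mulrA (_ : _ - _ - _ = c k * (w ^+ k - z ^+ k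
    - k%:R * z ^+ k.-1 * (w - z))).
    by rewrite modulusM ler_wpM2l ?modulus_ge0// modulus_taylor1_expr.
  by ring.
rewrite -mulr_suml ler_wpM2r ?sqr_ge0//.
(* The terms of index 0 and 1 vanish through the factor k (k - 1); the rest is a partial sum bounded
   by [K]. *)
rewrite !big_nat_recl//= !(mul0r,mulr0,add0r).
apply: le_trans (Kub _ _); last by exists N.
rewrite le_eqVlt; apply/orP; left; apply/eqP; apply: eq_bigr => k _.
by rewrite /deriv_coef !modulusM !modulus_natr; ring.
Qed.

(** Dividing the quadratic bound by the increment [w] shows that the difference quotient is within
    [K * modulus w] of the derived series. *)
Lemma power_series_derive1 (R : realType) (c : nat -> Cplx R) h :
  power_series_on_disc c h -> power_series_on_disc (deriv_coef c) (derive1 h).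
Proof.
move=> ch z dz.
have z1 : modulus z < 1 by rewrite -unit_discE.
have : cvgn (series (fun k => deriv_coef c k * z ^+ k)).
  apply: is_cvg_complex_series.
  rewrite (_ : (fun k => _) = fun k =>
    modulus (deriv_coef c k) * modulus z ^+ k).
    apply: abs_summable_deriv; first exact: power_series_abs_summable ch.
    by rewrite modulus_ge0.
  by apply/funext => k; rewrite modulusM modulusX.
move=> /cvg_ex[D cD]; have [r zr r1] := exists_between01 z1.
have [K KP] := power_series_taylor1 ch (ltW zr) r1 cD.
suff -> : derive1 h z = D by [].
apply: cvg_lim; first exact: norm_hausdorff.
apply/cvg_modulusP.
have K0 : K * modulus (w - 0) @[w --> (0 : Cplx R)^'] --> (0 : R).
  rewrite -[X in _ --> X](mulr0 K); apply: cvgM (cvg_cst _) _;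
    apply/cvg_modulusP.
  by apply: cvg_within; exact: cvg_id.
apply: (squeeze_cvgr _ (cvg_cst 0) K0).
near=> w; rewrite modulus_ge0 /= subr0.
have w0 : w != 0 by near: w; exact: nbhs_dnbhs_neq.
have : modulus (w + z) <= r.
  apply: le_trans (ler_modulusD _ _) _; rewrite -lerBrDr; apply: ltW.
  by rewrite -ltc_ofreal -normE; near: w; apply: dnbhs0_lt;
    rewrite -[0]/(ofreal 0) ltc_ofreal subr_gt0.
move=> /KP; rewrite addrK => wK.
have mw0 : 0 < modulus w by rewrite -ltc_ofreal -normE normr_gt0.
rewrite (_ : _ - D = w^-1 * (h (w + z) - h z - D * w)); last first.
  by rewrite mulrBr (mulrC D) mulKf.
rewrite modulusM [modulus w^-1]Normc.normcV -/(modulus w) mulrC ler_pdivrMr//.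
by rewrite -mulrA -expr2.
Unshelve. all: by end_near. Qed.

(** Follows from |h w - h z| <= K |w - z|^2 + |D| |w - z|. It serves at 0, to evaluate the limit in
    [quot_pow]. *)
Lemma power_series_continuous (R : realType) (c : nat -> Cplx R) h z :
  power_series_on_disc c h -> unit_disc z -> h w @[w --> z] --> h z.
Proof.
move=> ch dz.
have z1 : modulus z < 1 by rewrite -unit_discE.
have [r zr r1] := exists_between01 z1.
have [K KP] := power_series_taylor1 ch (ltW zr) r1 (power_series_derive1 ch dz).
set D := derive1 h z in KP.
apply/(cvg_modulusP (F := nbhs z)).
have m0 : modulus (w - z) @[w --> z] --> (0 : R).
  by have [+ _] := cvg_modulusP (F := nbhs z) id z; apply; exact: cvg_id.
have K0 : K * (modulus (w - z) * modulus (w - z)) + modulus D * modulus (w - z)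
    @[w --> z] --> (0 : R).
  have := cvgD (cvgM (cvg_cst K) (cvgM m0 m0)) (cvgM (cvg_cst (modulus D)) m0).
  by rewrite !mulr0 addr0 => H; apply: H.
apply: (squeeze_cvgr _ (cvg_cst 0) K0).
near=> w; rewrite modulus_ge0 /=.
have : modulus w <= r.
  rewrite -(subrK z w) (le_trans (ler_modulusD _ _))// -lerBrDr; apply: ltW.
  by near: w; apply: (cvgr_lt _ m0); rewrite subr_gt0.
move=> /KP wK; rewrite -[X in modulus X <= _](subrK (D * (w - z))).
by rewrite (le_trans (ler_modulusD _ _))// modulusM lerD2r -expr2.
Unshelve. all: by end_near. Qed.

(** * Action of the operators on coefficient sequences *)

Lemma power_seriesZ (R : realType) (x : Cplx R) (c : nat -> Cplx R) h :
  power_series_on_disc c h ->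
  power_series_on_disc (fun k => x * c k) (fun z => x * h z).
Proof.
move=> ch z dz.
rewrite (_ : series _ = fun n => x * series (fun k => c k * z ^+ k) n).
  by apply: cvgM (cvg_cst _) _; exact: ch.
by apply/funext => n; rewrite /series /= mulr_sumr; apply: eq_bigr => k _;
  rewrite mulrA.
Qed.

Lemma power_seriesD (R : realType) (c c' : nat -> Cplx R) h h' :
  power_series_on_disc c h -> power_series_on_disc c' h' ->
  power_series_on_disc (fun k => c k + c' k) (fun z => h z + h' z).
Proof.
move=> ch ch' z dz; rewrite (_ : series _ = fun n =>
    series (fun k => c k * z ^+ k) n + series (fun k => c' k * z ^+ k) n).
  by apply: cvgD; [exact: ch|exact: ch'].
by apply/funext => n; rewrite /series /= -big_split; apply: eq_bigr => k _;
  rewrite mulrDl.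
Qed.

(** Multiplying by [z] restores the exponent lowered by differentiation; the partial sums are
    shifted by one because the constant term is killed. *)
Lemma power_series_euler (R : realType) (c : nat -> Cplx R) h :
  power_series_on_disc c h ->
  power_series_on_disc (fun k => k%:R * c k) (fun z => z * derive1 h z).
Proof.
move=> ch z dz; rewrite -cvg_shiftS (_ : [sequence _]_n =
    fun n => z * series (fun k => deriv_coef c k * z ^+ k) n).
  by apply: cvgM (cvg_cst _) _; exact: power_series_derive1.
apply/funext => n; rewrite -series_deriv_coef /series /= mulr_sumr.
apply: eq_bigr => -[|k] _; first by rewrite !(mul0r,mulr0).
by rewrite /= exprS; ring.
Qed.

Lemma power_series_derive1n (R : realType) (c : nat -> Cplx R) h m :
  power_series_on_disc c h ->
  power_series_on_disc (fun k => ((k + m) ^_ m)%:R * c (k + m)%N)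
    (derive1n m h).
Proof.
move=> ch; elim: m => [|m IH].
  by rewrite (_ : (fun k => _) = c)//; apply/funext => k;
    rewrite addn0 ffactn0 mul1r.
rewrite derive1nS (_ : (fun k => _) =
    deriv_coef (fun k => ((k + m) ^_ m)%:R * c (k + m)%N)).
  exact: power_series_derive1.
apply/funext => k; rewrite /deriv_coef ffactnSr addSnnS mulrA -natrM.
by rewrite -addSnnS addnK mulnC.
Qed.

Lemma power_series_salagean (R : realType) (c : nat -> Cplx R) h p m :
  power_series_on_disc c h ->
  power_series_on_disc (fun k => k%:R / (p - m)%:R * c k) (salagean p m h).
Proof.
move=> /power_series_euler/(power_seriesZ (x := (p - m)%:R^-1)).
rewrite (_ : (fun k => _) = fun k => k%:R / (p - m)%:R * c k); last first.
  by apply/funext => k; rewrite mulrA mulrC [_ * k%:R]mulrC mulrC.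
rewrite (_ : (fun z => _) = salagean p m h)//.
by apply/funext => z; rewrite /salagean mulrA [_ * z]mulrC.
Qed.

(** With t = k / (p - m), each Salagean step multiplies the coefficient by t, and [calF] is (1 -
    lambda) times the [Omega]-th iterate plus lambda times the next one. *)
Lemma power_series_calF (R : realType) (c : nat -> Cplx R) h p m lambda Omega :
  power_series_on_disc c h ->
  power_series_on_disc
    (fun k => (1 - ofreal lambda + ofreal lambda * (k%:R / (p - m)%:R))
              * (k%:R / (p - m)%:R) ^+ Omega * c k)
    (calF p m lambda Omega h).
Proof.
move=> ch.
have /[dup] : power_series_on_disc (fun k => (k%:R / (p - m)%:R) ^+ Omega * c k)
    (iter Omega (salagean p m) h).
  elim: Omega => [|o IH].
    by rewrite (_ : (fun k => _) = c)//; apply/funext => k; rewrite mul1r.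
  rewrite iterS (_ : (fun k => _) =
      fun k => k%:R / (p - m)%:R * ((k%:R / (p - m)%:R) ^+ o * c k)).
    exact: power_series_salagean.
  by apply/funext => k; rewrite mulrA exprS.
move=> /(power_seriesZ (x := 1 - ofreal lambda)) h1.
move=> /(@power_series_salagean _ _ _ p m).
move=> /(power_seriesZ (x := ofreal lambda)) h2.
have := power_seriesD h1 h2.
rewrite (_ : (fun k => _) = fun k =>
    (1 - ofreal lambda + ofreal lambda * (k%:R / (p - m)%:R))
    * (k%:R / (p - m)%:R) ^+ Omega * c k); last first.
  by apply/funext => k; rewrite !mulrA -!mulrDl.
rewrite (_ : (fun z => _) = calF p m lambda Omega h)//.
by apply/funext => z; rewrite /calF /salagean !mulrA.
Qed.

Lemma power_series_quot_pow (R : realType) (c : nat -> Cplx R) h d :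
  power_series_on_disc c h -> (forall k, (k < d)%N -> c k = 0) ->
  power_series_on_disc (fun k => c (k + d)%N) (quot_pow d h).
Proof.
move=> ch c0.
(* [G] has the expected value [c d] at 0. It is first shown to be the sum of the shifted series; its
   continuity at 0 then identifies the limit in [quot_pow] with [c d]. *)
pose G z := if z == 0 then c d else h z / z ^+ d.
have cG : power_series_on_disc (fun k => c (k + d)%N) G.
  move=> z dz; rewrite /G; case: eqP => [->|/eqP z0].
    rewrite -cvg_shiftS (_ : [sequence _]_n = fun=> c d); first exact: cvg_cst.
    apply/funext => n; rewrite /series /= big_nat_recl// big1.
      by rewrite addr0 expr0 mulr1.
    move=> k _.
    by rewrite expr0n mulr0.
  rewrite (_ : series _ =
      fun n => series (fun k => c k * z ^+ k) (n + d)%N / z ^+ d).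
    apply: cvgM; last exact: cvg_cst.
    by rewrite (cvg_shiftn d (series _)); exact: ch.
  apply/funext => n; rewrite /series /=.
  rewrite [in RHS](@big_cat_nat _ _ _ d)//= ?leq_addl//.
  have -> : \sum_(0 <= k < d) c k * z ^+ k = 0.
    by rewrite big_nat big1// => k /andP[_ kd]; rewrite c0// mul0r.
  rewrite add0r.
  rewrite -{2}[d]add0n big_addn addnK mulr_suml; apply: eq_bigr => k _.
  by rewrite exprD mulrA mulfK// expf_neq0.
have d0 : unit_disc (0 : Cplx R) by rewrite unit_discE modulus0.
move=> z dz; suff -> : quot_pow d h z = G z by exact: cG.
rewrite /quot_pow /G; case: eqP => // _.
apply: cvg_lim; first exact: norm_hausdorff.
have := power_series_continuous cG d0.
rewrite [X in _ --> X](_ : _ = c d); last by rewrite /G eqxx.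
move=> /cvg_within_filter G0.
apply: (@cvg_trans _ (G w @[w --> (0 : Cplx R)^'])); last exact: G0.
apply: near_eq_cvg.
near=> w; rewrite /G ifN//; near: w; exact: nbhs_dnbhs_neq.
Unshelve. all: by end_near. Qed.

(** * From the expansion of f to that of the quotient *)

(** Merges the leading monomial and the tail into one sequence indexed by the exponent, masking the
    entries of [a] that [has_expansion] never reads. *)
Definition expansion_coef (R : realType) (n p : nat) (a : nat -> Cplx R) :
    nat -> Cplx R :=
  fun j => if j == p then 1 else if (n + p <= j)%N then a j else 0.

Lemma has_expansion_power_series (R : realType) n p (a : nat -> Cplx R) f :
  (0 < n)%N -> has_expansion n p a f ->
  power_series_on_disc (expansion_coef n p a) f.
Proof.
(* After a shift by [p.+1] even the first partial sum contains z^p, and only z^p since [n] is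
   positive. *)
move=> n0 af z dz; rewrite -(cvg_shiftn p.+1).
rewrite (_ : [sequence _]_N = fun N =>
    z ^+ p + \sum_(n <= k < N.+1) a (k + p)%N * z ^+ (k + p)).
  by rewrite (cvg_shiftS (fun N =>
    z ^+ p + \sum_(n <= k < N) a (k + p)%N * z ^+ (k + p))); exact: af.
apply/funext => N; rewrite /series /=; elim: N => [|N IH].
  rewrite add0n big_nat_recr//= big_nat big1 => [|k /andP[_ kp]]; last first.
    by rewrite /expansion_coef ltn_eqF// leqNgt ltn_addl// mul0r.
  by rewrite /expansion_coef eqxx mul1r add0r big_geq ?addr0.
rewrite addSn big_nat_recr//= IH -addrA; congr (_ + _).
rewrite addnS -addSn /expansion_coef -[X in _ == X]add0n eqn_add2r /=.
rewrite leq_add2r; case: leqP => nN; first by rewrite [in RHS]big_nat_recr.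
by rewrite mul0r addr0 !big_geq// ltnW.
Qed.

(** The length of a chord of the unit circle: expand the squares and use cos^2 + sin^2 = 1. *)
Lemma modulus_expiB (R : realType) (x y : R) :
  modulus (expi x - expi y) = Num.sqrt (2 * (1 - cos (x - y))).
Proof.
rewrite /modulus /expi /=; congr Num.sqrt; rewrite cosB.
have := cos2Dsin2 x; have := cos2Dsin2 y; nra.
Qed.

Definition quot_coef (R : realType) (n p : nat) (lambda : R) (m Omega : nat)
    (a : nat -> Cplx R) : nat -> Cplx R :=
  fun k => ofreal (coef p m lambda Omega k) * expansion_coef n p a (k + p).

(** Composes the rules for [derive1n], [calF] and [quot_pow]; what remains is to recognise the
    resulting multiplier as [coef]. *)
Lemma in_class_quot_pow (R : realType) n p lambda m Omega
    (a : nat -> Cplx R) f :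
  (0 < n)%N -> (m < p)%N -> in_class n p lambda m Omega a f ->
  power_series_on_disc (quot_coef n p lambda m Omega a)
    (quot_pow (p - m) (calF p m lambda Omega (derive1n m f))).
Proof.
move=> n0 mp [/(has_expansion_power_series n0) af _].
have /(@power_series_calF _ _ _ p m lambda Omega) :=
  power_series_derive1n (m := m) af.
move=> /(@power_series_quot_pow _ _ _ (p - m)).
have mp' := ltnW mp.
have pm0 : ((p - m)%:R : R) != 0 by rewrite pnatr_eq0 subn_eq0 -ltnNge.
move=> H z dz; have := H _ z dz.
rewrite (_ : (fun k => _) = fun k => quot_coef n p lambda m Omega a k * z ^+ k).
  apply=> k kd; have kp : (k + m < p)%N by rewrite addnC -ltn_subRL.
  by rewrite /expansion_coef ltn_eqF// leqNgt ltn_addl// !mulr0.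
apply/funext => k; congr (_ * _).
rewrite /quot_coef -addnA subnK// mulrA; congr (_ * _).
rewrite addnBA// /coef.
(* Splitting the factorial lets (k + p - m)! cancel in [coef], leaving the falling factorial
   produced by the m-th derivative. *)
rewrite -[(k + p)`!](ffact_fact (m := m)) ?(leq_trans mp') ?leq_addl//.
set X := ((k + p) ^_ m)%N; set J := (k + p - m)%N.
have JE : J%:R = k%:R + (p - m)%:R :> R by rewrite -natrD addnBA.
have Y0 : (J`!%:R : R) != 0 by rewrite pnatr_eq0 -lt0n fact_gt0.
(* The multiplier is gathered into one real number. Since J / (p - m) = 1 + k / (p - m), the first
   factor equals 1 + lambda k / (p - m). *)
transitivity (ofreal ((1 - lambda + lambda * (J%:R / (p - m)%:R))
    * (J%:R / (p - m)%:R) ^+ Omega * X%:R)).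
  rewrite -!(rmorph_nat (real_complex R)) /ofreal.
  by rewrite !(rmorphM, rmorphD, rmorphN, rmorphXn, rmorph1, fmorphV).
congr ofreal; rewrite !natrM !natrX expr_div_n {1}JE.
have dO : ((p - m)%:R : R) ^+ Omega != 0 by rewrite expf_neq0.
by field; rewrite pm0 dO Y0.
Qed.

(** * The final estimate *)

Lemma coef_ge0 (R : realType) p m (lambda : R) Omega k :
  0 <= lambda -> 0 <= coef p m lambda Omega k.
Proof.
by move=> l0; rewrite /coef !(mulr_ge0, invr_ge0, addr_ge0, ler0n).
Qed.

Lemma coef0 (R : realType) p m (lambda : R) Omega :
  (m < p)%N -> coef p m lambda Omega 0 = p`!%:R / (p - m)`!%:R.
Proof.
move=> mp; rewrite /coef add0n mulr0 mul0r addr0 mulr1.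
rewrite -mulf_div divff ?mul1r// pnatr_eq0 expn_eq0 subn_eq0.
by rewrite leqNgt mp.
Qed.

Theorem theorem2p4 (R : realType) (n p m Omega : nat) (lambda : R)
    (hn : (0 < n)%N) (hpm : (m < p)%N) (hlambda : 0 <= lambda <= 1)
    (a b : nat -> Cplx R) (f g : Cplx R -> Cplx R)
    (hf : in_class n p lambda m Omega a f)
    (hg : in_class n p lambda m Omega b g)
    (alpha beta delta : R)
    (hab : - pi <= alpha - beta <= pi)
    (hdelta : delta_bound p m alpha beta < delta)
    (hsum : (\sum_(n <= k <oo)
               (coef p m lambda Omega k
                * modulus (expi alpha * a (k + p)%N
                           - expi beta * b (k + p)%N))%:E
             <= (delta - delta_bound p m alpha beta)%:E)%E) :
  in_M alpha beta lambda m delta Omega p g f.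
Proof.
have /andP[l0 _] := hlambda.
move=> z dz; have z1 : modulus z < 1 by rewrite -unit_discE.
rewrite normE ltc_ofreal.
pose e k := coef p m lambda Omega k *
  modulus (expi alpha * a (k + p)%N - expi beta * b (k + p)%N).
have e0 k : 0 <= e k by rewrite mulr_ge0 ?coef_ge0 ?modulus_ge0.
(* The terms are nonnegative, so each partial sum is at most the extended-real sum. *)
have esum N : \sum_(n <= k < N) e k <= delta - delta_bound p m alpha beta.
  rewrite -lee_fin -sumEFin; apply: le_trans hsum.
  by apply: nneseries_lim_ge => k _ _; rewrite lee_fin; exact: e0.
have hh := power_seriesD
  (power_seriesZ (x := expi alpha) (in_class_quot_pow hn hpm hf))
  (power_seriesZ (x := - expi beta) (in_class_quot_pow hn hpm hg)).
have := hh z dz; rewrite mulNr -cvg_shiftS => cz.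
set B := delta_bound p m alpha beta in hdelta esum *.
(* A strict bound on partial sums would only give a weak one in the limit; this intermediate value
   is strictly below [delta] because [modulus z < 1] and [B < delta]. *)
apply: (@le_lt_trans _ _ (B + modulus z * (delta - B))); last first.
  by rewrite -ltrBrDl gtr_pMl ?subr_gt0.
apply: (modulus_cvg_le cz) => N; rewrite /series /=;
  apply: le_trans (ler_modulus_sum _ _) _.
have nE k : (n + p <= k + p)%N = (n <= k)%N by rewrite leq_add2r.
(* The constant term is p! / (p - m)! times [expi alpha - expi beta], whose modulus is [B]. *)
rewrite big_nat_recl//; apply: lerD.
  rewrite /quot_coef /expansion_coef add0n eqxx !mulr1 mulNr -mulrBl modulusM.
  rewrite modulus_expiB modulus_ofreal coef0// ger0_norm ?divr_ge0//.
  by rewrite mulrC.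
(* Every remaining exponent is at least 1, so one factor [modulus z] comes out and the other powers
   are bounded by 1. *)
apply: (@le_trans _ _ (\sum_(0 <= k < N)
    modulus z * (if (n <= k.+1)%N then e k.+1 else 0))).
  apply: ler_sum => k _.
  rewrite /quot_coef /expansion_coef -[X in _ == X]add0n eqn_add2r /= nE.
  case: ifP => _; last by rewrite !mulr0 addr0 mul0r modulus0.
  rewrite (_ : _ * z ^+ k.+1 = ofreal (coef p m lambda Omega k.+1) *
    (expi alpha * a (k.+1 + p)%N - expi beta * b (k.+1 + p)%N) * z ^+ k.+1);
      last by ring.
  rewrite 2!modulusM modulus_ofreal ger0_norm ?coef_ge0// -/(e k.+1) mulrC.
  rewrite ler_wpM2r// modulusX exprS ler_piMr ?modulus_ge0//.
  by rewrite exprn_ile1 ?modulus_ge0// ltW.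
rewrite -mulr_sumr ler_wpM2l ?modulus_ge0//.
apply: le_trans (esum N.+1).
(* Both sums are put over all indices with a guard; index 0 contributes nothing because [0 < n]. *)
rewrite (big_nat_widenl n 0)//= [leRHS]big_mkcond [leRHS]big_nat_recl//=.
by rewrite leqNgt hn add0r.
Qed.
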